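(* Let $\mathcal{H}_A,\mathcal{H}_B$ have finite dimensions $d_A,d_B$, and put $d=\min\{d_A,d_B\}$, $D=\max\{d_A,d_B\}$. Let $\rho$ be a separable state on $\mathcal{H}_A\otimes\mathcal{H}_B$ in Filter Normal Form, and let $h$ be an integer with $\sqrt{Dd}\le h\le d^2$. Then $$\mathcal{M}_{h,p=\infty}(\rho)\le\frac{1}{\sqrt{Dd}}\left[\frac{D-1}{D(h-1)}\cdot\frac{d-1}{d(h-1)}\right]^{\frac{h-1}{2}}.$$
   Context: Let $\{A_i\}_{i=1}^{d_A^2}$ be an orthonormal basis of the real vector space of $d_A\times d_A$ Hermitian matrices w.r.t. the Hilbert–Schmidt inner product $\mathrm{tr}(XY)$, and $\{B_j\}_{j=1}^{d_B^2}$ likewise for $d_B\times d_B$. The correlation matrix of a state $\rho$ is $\mathcal{C}_{ij}=\mathrm{tr}(\rho\,A_i\otimes B_j)$, with singular values $\sigma_1\ge\cdots\ge\sigma_{d^2}\ge0$ (independent of the choice of bases). $\mathcal{M}_{h,p=\infty}(\rho)$ is the Schatten $\infty$-norm (largest singular value) of the $h$-th compound matrix of $\mathcal{C}$, i.e. $\mathcal{M}_{h,\infty}(\rho)=\prod_{k=1}^h\sigma_k$. A state is separable if it is a convex combination of product states. A state $\rho$ is in Filter Normal Form if $\mathrm{tr}(\rho\,(A\otimes\mathbb{1}))=0$ for every traceless Hermitian $A$ on $\mathcal{H}_A$ and $\mathrm{tr}(\rho\,(\mathbb{1}\otimes B))=0$ for every traceless Hermitian $B$ on $\mathcal{H}_B$.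 *)

(* Defs.v *)
From HB Require Import structures.
From mathcomp Require Import all_boot all_order all_algebra.
From mathcomp Require Import complex mxtens.
From mathcomp Require Import boolp classical_sets reals.
Set Implicit Arguments.
Unset Strict Implicit.
Unset Printing Implicit Defensive.
Import Order.TTheory GRing.Theory Num.Theory.
Local Open Scope ring_scope.
Local Open Scope classical_set_scope.

Section QInfo.
Variable R : realType.
Local Notation C := R[i].

Definition adjmx m n (A : 'M[C]_(m, n)) : 'M[C]_(n, m) :=
  \matrix_(i, j) conjc (A j i).

Definition hermitian n (A : 'M[C]_n) : Prop := adjmx A = A.

Definition psd n (A : 'M[C]_n) : Prop :=
  forall v : 'cV[C]_n, 0 <= (adjmx v *m A *m v) 0 0.

Definition density n (A : 'M[C]_n) : Prop :=
  [/\ hermitian A, psd A & \tr A = 1].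

(* a family of n^2 Hermitian matrices, orthonormal for tr(XY); since the real
   space of n x n Hermitian matrices has dimension n^2 this is exactly an
   orthonormal basis *)
Definition orthonormal_herm_basis n (A : 'I_(n ^ 2) -> 'M[C]_n) : Prop :=
  (forall i, hermitian (A i)) /\
  (forall i j, \tr (A i *m A j) = (i == j)%:R).

Definition separable dA dB (rho : 'M[C]_(dA * dB)) : Prop :=
  exists k (p : 'I_k -> R) (rA : 'I_k -> 'M[C]_dA) (rB : 'I_k -> 'M[C]_dB),
    [/\ (forall l, 0 <= p l), \sum_l p l = 1,
        (forall l, density (rA l)), (forall l, density (rB l)) &
        rho = \sum_l real_complex R (p l) *: (rA l *t rB l)].

Definition filter_normal_form dA dB (rho : 'M[C]_(dA * dB)) : Prop :=
  (forall X : 'M[C]_dA, hermitian X -> \tr X = 0 ->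
      \tr (rho *m (X *t (1%:M : 'M[C]_dB))) = 0) /\
  (forall Y : 'M[C]_dB, hermitian Y -> \tr Y = 0 ->
      \tr (rho *m ((1%:M : 'M[C]_dA) *t Y)) = 0).

(* correlation matrix C_ij = tr(rho A_i (x) B_j) (a real number, since rho and
   A_i (x) B_j are Hermitian; we take its real part) *)
Definition corr_mx dA dB (rho : 'M[C]_(dA * dB))
  (A : 'I_(dA ^ 2) -> 'M[C]_dA) (B : 'I_(dB ^ 2) -> 'M[C]_dB)
  : 'M[R]_(dA ^ 2, dB ^ 2) :=
  \matrix_(i, j) complex.Re (\tr (rho *m (A i *t B j))).

Definition hsub n h := {S : {set 'I_n} | #|S| == h}.

(* minor of M with rows S and columns T (both listed in increasing order) *)
Definition minor m n (M : 'M[R]_(m, n)) h (S : {set 'I_m}) (T : {set 'I_n}) : R :=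
  \det (\matrix_(i < h, j < h)
          nth 0 (nth [::] [seq [seq M r c | c <- enum T] | r <- enum S] i) j).

Definition compound m n (M : 'M[R]_(m, n)) h : hsub m h -> hsub n h -> R :=
  fun I J => minor M h (val I) (val J).

Definition vnorm (J : finType) (x : J -> R) : R := Num.sqrt (\sum_j x j ^+ 2).

(* Schatten infinity-norm = l2 operator norm = largest singular value *)
Definition schatten_inf (I J : finType) (K : I -> J -> R) : R :=
  sup [set vnorm (fun i => \sum_j K i j * x j) | x in [set x : J -> R | vnorm x <= 1]].

Definition M_h_inf dA dB (rho : 'M[C]_(dA * dB))
  (A : 'I_(dA ^ 2) -> 'M[C]_dA) (B : 'I_(dB ^ 2) -> 'M[C]_dB) h : R :=
  schatten_inf (@compound _ _ (corr_mx rho A B) h).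

End QInfo.

(* Main.v *)
Require Import Defs.
From HB Require Import structures.
From mathcomp Require Import all_boot all_order all_fingroup all_algebra.
From mathcomp Require Import complex mxtens spectral sesquilinear.
From mathcomp Require Import boolp classical_sets reals.
From mathcomp Require Import ring.
Import Order.TTheory GRing.Theory Num.Theory.
Local Open Scope ring_scope.
Set Implicit Arguments.
Unset Strict Implicit.
Unset Printing Implicit Defensive.

(** Write the Bloch vectors of the product states as [e / sqrt dA + a_l] and
[f / sqrt dB + b_l], where [e] and [f] are the unit vectors of the identity
matrices, [a_l] is orthogonal to [e], [b_l] to [f], and purity at most [1] gives
[|a_l|^2 <= 1 - 1/dA], [|b_l|^2 <= 1 - 1/dB].  The normal form kills the cross
terms, so the correlation matrix is [c e f^T + sum_l p_l a_l b_l^T] with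
[c = 1 / sqrt (dA dB)].  After rescaling the [a_l] and [b_l] against each other
it factors as [F G^T], where [F F^T] and [G G^T] are positive with eigenvalue
[c], the other eigenvalues summing to at most
[s = sqrt ((1 - 1/dA) (1 - 1/dB)) <= h c].  By AM-GM any product of [h]
eigenvalues, taken at distinct indices, is at most
[b = c (s / (h - 1))^(h - 1)]; hence the compounds of [F] and [G] have norm at
most [sqrt b], and that of [F G^T] at most [b].

Compounds are handled inside the tensor power: an [h]-vector becomes a function
on [h]-tuples of indices vanishing off the injective ones, on which [M] acts by
its tensor power, so that functoriality and adjoints are immediate and only the
row expansion of a determinant is needed. *)

(** * Tensor powers of matrices and antisymmetric tensors *)

Section TensorPower.
Variables (K : comNzRingType) (h : nat).

Definition tensor_act m n (M : 'M[K]_(m, n)) (X : {ffun 'I_h -> 'I_n} -> K)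
    (t : {ffun 'I_h -> 'I_m}) : K :=
  \sum_(s : {ffun 'I_h -> 'I_n}) (\prod_i M (t i) (s i)) * X s.

Definition tensor_dot n (X Y : {ffun 'I_h -> 'I_n} -> K) : K :=
  \sum_t X t * Y t.

Lemma tensor_act_tr m n (M : 'M[K]_(m, n)) X Y :
  tensor_dot (tensor_act M X) Y = tensor_dot X (tensor_act M^T Y).
Proof.
rewrite /tensor_dot /tensor_act.
under eq_bigr do rewrite mulr_suml.
rewrite exchange_big /=; apply: eq_bigr => s _; rewrite mulr_sumr.
apply: eq_bigr => t _; rewrite mulrCA -mulrA; congr (_ * _).
by apply: eq_bigr => i _; rewrite mxE.
Qed.

(** A product over positions of sums over a middle index expands into a sum over middle tuples. All
    tuples are needed for this, not only injective ones. *)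
Lemma tensor_act_mul m n p (M : 'M[K]_(m, n)) (N : 'M[K]_(n, p)) X :
  tensor_act M (tensor_act N X) =1 tensor_act (M *m N) X.
Proof.
move=> t; rewrite /tensor_act.
under eq_bigr do rewrite mulr_sumr.
rewrite exchange_big /=; apply: eq_bigr => s _.
under eq_bigr do rewrite mulrA -big_split /=.
rewrite -mulr_suml; congr (_ * _).
rewrite -(bigA_distr_bigA (fun i j => M (t i) j * N j (s i))) /=.
by apply: eq_bigr => i _; rewrite mxE.
Qed.

Lemma eq_tensor_act m n (M : 'M[K]_(m, n)) X Y :
  X =1 Y -> tensor_act M X =1 tensor_act M Y.
Proof. by move=> XY t; apply: eq_bigr => s _; rewrite XY. Qed.

Lemma eq_tensor_dot n (X X' Y Y' : {ffun 'I_h -> 'I_n} -> K) :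
  X =1 X' -> Y =1 Y' -> tensor_dot X Y = tensor_dot X' Y'.
Proof. by move=> XX YY; apply: eq_bigr => t _; rewrite XX YY. Qed.

Lemma tensor_act_diag n (l : 'rV[K]_n) X t :
  tensor_act (diag_mx l) X t = (\prod_i l 0 (t i)) * X t.
Proof.
rewrite /tensor_act (bigD1 t) //= [X in _ + X]big1 ?addr0 => [|s /eqP neq_st].
  by congr (_ * _); apply: eq_bigr => i _; rewrite mxE eqxx.
have [i /eqP neq_i] : exists i, t i <> s i.
  by apply/existsNP => eq_ts; apply: neq_st; apply/ffunP => i; rewrite eq_ts.
by rewrite (bigD1 i) //= mxE (negbTE neq_i) mulr0n !mul0r.
Qed.

Lemma tensor_act1 n (X : {ffun 'I_h -> 'I_n} -> K) : tensor_act 1%:M X =1 X.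
Proof.
move=> t; rewrite -diag_const_mx tensor_act_diag big1 ?mul1r // => i _.
by rewrite mxE.
Qed.

(** Multilinearity of the determinant in its rows. Since [s] runs over all maps, the terms need no
    regrouping by image as in Cauchy-Binet. *)
Lemma det_mul_expand n (M : 'M[K]_(h, n)) (N : 'M[K]_(n, h)) :
  \det (M *m N) = \sum_(s : {ffun 'I_h -> 'I_n})
    (\prod_i M i (s i)) * \det (\matrix_(i, j) N (s i) j).
Proof.
under [RHS]eq_bigr => s _ do rewrite /determinant mulr_sumr.
rewrite exchange_big /=; apply: eq_bigr => sg _.
under [RHS]eq_bigr => s _ do
  [rewrite mulrCA; under [X in _ * (_ * X)]eq_bigr do rewrite mxE].
under [RHS]eq_bigr do rewrite -big_split /=.
rewrite -mulr_sumr; congr (_ * _).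
rewrite -(bigA_distr_bigA (fun i j => M i j * N j (sg i))) /=.
by apply: eq_bigr => i _; rewrite mxE.
Qed.

(** Lists the elements of [S] in the order of [enum], the one that [minor] uses. *)
Definition hsub_val n (S : hsub n h) (i : 'I_h) : 'I_n :=
  enum_val (cast_ord (esym (eqP (valP S))) i).

Lemma hsub_val_inj n (S : hsub n h) : injective (hsub_val S).
Proof. by move=> i j /enum_val_inj /cast_ord_inj. Qed.

Lemma hsub_val_in n (S : hsub n h) i : hsub_val S i \in val S.
Proof. exact: enum_valP. Qed.

Lemma hsub_valP n (S : hsub n h) a : a \in val S -> exists i, a = hsub_val S i.
Proof.
move=> aS; exists (cast_ord (eqP (valP S)) (enum_rank_in aS a)).
by rewrite /hsub_val cast_ordK enum_rankK_in.
Qed.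

(* With x a vector of the h-th exterior power, written in the basis indexed by
   h-subsets, this is the antisymmetric tensor representing M^(wedge h) x, up
   to the normalisation h!. *)
Definition ext_tensor m n (M : 'M[K]_(m, n)) (x : hsub n h -> K)
    (t : {ffun 'I_h -> 'I_m}) : K :=
  \sum_S x S * \det (\matrix_(i < h, j < h) M (t i) (hsub_val S j)).

(** For each [S] this is the row expansion of the determinant of a product. Tensor powers therefore
    preserve antisymmetric tensors. *)
Lemma tensor_act_ext m n p (M : 'M[K]_(m, n)) (N : 'M[K]_(n, p)) x :
  tensor_act M (ext_tensor N x) =1 ext_tensor (M *m N) x.
Proof.
move=> t; rewrite /tensor_act /ext_tensor.
under eq_bigr do rewrite mulr_sumr.
rewrite exchange_big /=; apply: eq_bigr => S _.
under eq_bigr do rewrite mulrCA.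
rewrite -mulr_sumr; congr (_ * _).
transitivity (\det ((\matrix_(i < h, j < n) M (t i) j) *m
                    (\matrix_(i < n, j < h) N i (hsub_val S j)))).
  rewrite det_mul_expand; apply: eq_bigr => s _; congr (_ * _).
    by apply: eq_bigr => i _; rewrite mxE.
  by congr (\det _); apply/matrixP => i j; rewrite !mxE.
congr (\det _); apply/matrixP => i j; rewrite !mxE.
by apply: eq_bigr => k _; rewrite !mxE.
Qed.

Lemma ext_tensor_ninj m n (M : 'M[K]_(m, n)) x (t : {ffun 'I_h -> 'I_m}) :
  ~~ injectiveb t -> ext_tensor M x t = 0.
Proof.
case/injectivePn=> i [j neq_ij eq_t]; rewrite /ext_tensor big1 // => S _.
rewrite (determinant_alternate neq_ij) ?mulr0 // => k.
by rewrite !mxE eq_t.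
Qed.

Lemma ext_tensor_perm m n (M : 'M[K]_(m, n)) x
    (t : {ffun 'I_h -> 'I_m}) (s : 'S_h) :
  ext_tensor M x [ffun i => t (s i)] = (-1) ^+ s * ext_tensor M x t.
Proof.
rewrite /ext_tensor mulr_sumr; apply: eq_bigr => S _; rewrite mulrCA.
congr (_ * _); rewrite -det_perm -det_mulmx -row_permE.
by congr (\det _); apply/matrixP => i j; rewrite !mxE ffunE.
Qed.

(** Group the injective tuples by their image: each [h]-subset is the image of [h!] of them, and
    these differ by permutations of the positions. *)
Lemma sum_inj_ffun n (F : {ffun 'I_h -> 'I_n} -> K) :
  (forall t : {ffun _ -> _}, ~~ injectiveb t -> F t = 0) ->
  (forall (t : {ffun _ -> _}) (s : 'S_h), F [ffun i => t (s i)] = F t) ->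
  \sum_t F t = h`!%:R * \sum_(S : hsub n h) F [ffun i => hsub_val S i].
Proof.
move=> F0 Fs; rewrite mulr_sumr.
transitivity (\sum_(S : hsub n h)
   \sum_(t : {ffun 'I_h -> 'I_n} | (t \in ffun_on (mem (val S))) && injectiveb t)
     F t); last first.
  apply: eq_bigr => S _.
  rewrite (eq_bigr (fun=> F [ffun i => hsub_val S i])); last first.
    move=> t /andP[/ffun_onP tS /injectiveP t_inj].
    have /fin_all_exists[s sE] := fun i => hsub_valP (tS i).
    have s_inj : injective s.
      by move=> i j eq_s; apply: t_inj; rewrite !sE eq_s.
    rewrite -(Fs [ffun i => hsub_val S i] (perm s_inj)); congr F; apply/ffunP => i.
    by rewrite !ffunE permE sE.
  rewrite sumr_const mulr_natl; congr (_ *+ _).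
  have := @card_inj_ffuns_on 'I_h 'I_n (mem (val S)).
  by rewrite card_ord (eqP (valP S)) ffactnn cardsE.
rewrite (exchange_big_dep (fun t : {ffun _ -> _} => injectiveb t)) /=;
  last by move=> S t _ /andP[].
rewrite (bigID (fun t : {ffun _ -> _} => injectiveb t)) /= [X in _ + X]big1 ?addr0 //.
apply: eq_bigr => t t_inj; have im_t : #|t @: 'I_h| == h.
  by rewrite card_imset ?card_ord //; apply/injectiveP.
rewrite (big_pred1 (Sub (t @: 'I_h) im_t : hsub n h)) //= => S.
rewrite t_inj andbT; apply/ffun_onP/eqP => [tS|-> i]; last exact: imset_f.
apply/val_inj/esym/eqP; rewrite eqEcard (eqP im_t) (eqP (valP S)) leqnn andbT.
by apply/fintype.subsetP => a /imsetP[i _ ->].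
Qed.

End TensorPower.

(** * Compound matrices as antisymmetric tensors *)

Section Compound.
Variables (R : realType) (h : nat).

(** Both enumerations have length exactly [h], so the defaults of [nth] in [minor] are never
    reached. *)
Lemma compoundE m n (M : 'M[R]_(m, n)) (S : hsub m h) (T : hsub n h) :
  compound M S T =
  \det (\matrix_(i < h, j < h) M (hsub_val S i) (hsub_val T j)).
Proof.
rewrite /compound /minor; congr (\det _); apply/matrixP => i j; rewrite !mxE.
have szS : size (enum (val S)) = h by rewrite -cardE (eqP (valP S)).
have szT : size (enum (val T)) = h by rewrite -cardE (eqP (valP T)).
rewrite (nth_map (hsub_val S i)) ?szS // (nth_map (hsub_val T j)) ?szT //.
by congr (M _ _); apply/esym/enum_val_nth.
Qed.

(** If [S] and [T] differ, some element of [S] lies outside [T], and its row in the minor is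
    zero. *)
Lemma compound1 n (S T : hsub n h) :
  compound (1%:M : 'M[R]_n) S T = (S == T)%:R.
Proof.
rewrite compoundE; have [<-|neq_ST] := eqVneq S T.
  rewrite -[RHS](det1 _ h); congr (\det _); apply/matrixP => i j.
  by rewrite !mxE (inj_eq (@hsub_val_inj _ _ _)).
have [i iT] : exists i, hsub_val S i \notin val T.
  apply/existsP; rewrite -negb_forall; apply: contra neq_ST => /forallP ST.
  rewrite -val_eqE eqEcard (eqP (valP S)) (eqP (valP T)) leqnn andbT.
  by apply/fintype.subsetP => a /hsub_valP[i ->].
rewrite (expand_det_row _ i) big1 // => j _; rewrite !mxE.
case: eqP => [eq_ij|]; last by rewrite mul0r.
by rewrite eq_ij hsub_val_in in iT.
Qed.

(** The square of an antisymmetric tensor is invariant under permutations, so the sum over tuples is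
    [h!] times the sum over subsets. This turns norms of compounds into norms in the tensor
    power. *)
Lemma tensor_dot_ext m n (M : 'M[R]_(m, n)) (x : hsub n h -> R) :
  tensor_dot (ext_tensor M x) (ext_tensor M x) =
  h`!%:R * \sum_S (\sum_T compound M S T * x T) ^+ 2.
Proof.
rewrite /tensor_dot sum_inj_ffun => [|t t_ninj|t s].
- congr (_ * _); apply: eq_bigr => S _; rewrite -expr2; congr (_ ^+ 2).
  apply: eq_bigr => T _; rewrite mulrC compoundE; congr (_ * _).
  by congr (\det _); apply/matrixP => i j; rewrite !mxE ffunE.
- by rewrite ext_tensor_ninj // mul0r.
- by rewrite ext_tensor_perm mulrACA -expr2 sqrr_sign mul1r.
Qed.

Lemma tensor_dot_ext1 n (x : hsub n h -> R) :
  tensor_dot (ext_tensor 1%:M x) (ext_tensor 1%:M x) =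
  h`!%:R * \sum_S x S ^+ 2.
Proof.
rewrite tensor_dot_ext; congr (_ * _); apply: eq_bigr => S _; congr (_ ^+ 2).
rewrite (bigD1 S) //= compound1 eqxx mul1r big1 ?addr0 // => T neq_TS.
by rewrite compound1 eq_sym (negbTE neq_TS) mul0r.
Qed.

(** By Lagrange's identity, twice the difference is a double sum of squares. *)
Lemma cauchy_schwarz_sum (I : finType) (a b : I -> R) :
  (\sum_i a i * b i) ^+ 2 <= (\sum_i a i * a i) * (\sum_i b i * b i).
Proof.
rewrite -subr_ge0 -(@pmulr_rge0 _ 2) //.
suff -> : 2 * ((\sum_i a i * a i) * (\sum_i b i * b i) - (\sum_i a i * b i) ^+ 2)
   = \sum_i \sum_j (a i * b j - a j * b i) ^+ 2.
  by apply: sumr_ge0 => i _; apply: sumr_ge0 => j _; apply: sqr_ge0.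
transitivity (\sum_i \sum_j (a i * a i * (b j * b j) + b i * b i * (a j * a j)
     - 2 * (a i * b i * (a j * b j)))); last first.
  by apply: eq_bigr => i _; apply: eq_bigr => j _; ring.
under [RHS]eq_bigr do rewrite sumrB big_split /= -!mulr_sumr.
rewrite sumrB big_split /= -!mulr_suml -mulr_sumr -mulr_suml; ring.
Qed.

End Compound.

(** * Spectral decomposition of positive matrices and purity of states *)

Section Spectral.
Variable R : realType.
Local Notation C := R[i].

Lemma psd_spectral n (P : 'M[C]_n) : Defs.hermitian P -> psd P ->
  exists (Q : 'M[C]_n) (l : 'I_n -> R),
    [/\ adjmx Q *m Q = 1%:M, forall i, 0 <= l i &
        P = adjmx Q *m diag_mx (\row_i (real_complex R (l i))) *m Q].
Proof.
move=> Pherm Ppsd.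
have adjE m k (M : 'M[C]_(m, k)) : map_mx Num.conj M^T = adjmx M.
  by apply/matrixP => i j; rewrite !mxE.
have Phs : P \is hermsymmx.
  by apply/is_hermitianmxP; rewrite expr0 scale1r adjE Pherm.
have /hermitian_normalmx /orthomx_spectralP := Phs.
set Q := spectralmx P; set D := spectral_diag P => PE.
have Qu : Q \is unitarymx by apply: spectral_unitarymx.
rewrite invmx_unitary // adjE in PE.
have QQ : Q *m adjmx Q = 1%:M by rewrite -adjE; apply/unitarymxP.
have D_ge0 i : 0 <= D 0 i.
  (* The test vector is the [i]-th eigenvector, at which the quadratic form takes the value
     [D 0 i]. *)
  have := Ppsd (adjmx Q *m delta_mx i 0).
  have -> : adjmx (adjmx Q *m delta_mx i (0 : 'I_1)) = delta_mx 0 i *m Q.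
    rewrite -adjE trmx_mul map_mxM -!adjE trmxCK trmx_delta.
    by rewrite map_delta_mx.
  rewrite PE !mulmxA -[_ *m Q *m adjmx Q]mulmxA QQ mulmx1.
  rewrite -[_ *m Q *m adjmx Q]mulmxA QQ mulmx1.
  by rewrite -rowE -colE !mxE eqxx mulr1n.
have DE i : real_complex R (complex.Re (D 0 i)) = D 0 i.
  by apply: RRe_real; apply: ger0_real.
exists Q, (fun i => complex.Re (D 0 i)); split.
- exact: mulmx1C.
- by move=> i; rewrite -ler0c DE.
- by rewrite {1}PE; congr (_ *m diag_mx _ *m _); apply/rowP => i; rewrite mxE DE.
Qed.

(** The eigenvalues are nonnegative with sum 1, so each is at most 1 and dominates its square. *)
Lemma density_purity n (P : 'M[C]_n) : density P ->
  \tr (P *m P) <= 1.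
Proof.
case=> Pherm Ppsd trP.
have [Q [l [QQ l_ge0 PE]]] := psd_spectral Pherm Ppsd.
have QQ' := mulmx1C QQ.
have suml : \sum_i l i = 1.
  apply: (@complexI R); rewrite rmorph_sum rmorph1 -trP PE mxtrace_mulC.
  rewrite mulmxA QQ' mul1mx mxtrace_diag.
  by apply: eq_bigr => i _; rewrite mxE.
have -> : \tr (P *m P) = real_complex R (\sum_i l i ^+ 2).
  rewrite PE -!mulmxA mxtrace_mulC -!mulmxA QQ' mulmx1 (mulmxA Q) QQ' mul1mx.
  rewrite mulmx_diag mxtrace_diag rmorph_sum.
  by apply: eq_bigr => i _; rewrite !mxE rmorphXn expr2.
rewrite -[1](rmorph1 (real_complex R)) lecR -suml.
apply: ler_sum => i _; rewrite expr2 ler_piMl // -suml (bigD1 i) //= lerDl.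
by apply: sumr_ge0.
Qed.

End Spectral.

(** * Products of eigenvalues at distinct indices *)

Section ProductBound.
Variable R : realType.

Lemma ler_sum_inj (I J : finType) (t : I -> J) (P : pred I) (Q : pred J)
    (F : J -> R) :
  injective t -> (forall j, 0 <= F j) -> (forall i, P i -> Q (t i)) ->
  \sum_(i | P i) F (t i) <= \sum_(j | Q j) F j.
Proof.
move=> t_inj F_ge0 PQ.
rewrite -(big_imset F (h := t) (A := P)) /=; last by move=> ? ? _ _; apply: t_inj.
rewrite [leRHS](bigID (mem (t @: P))) /= [X in X + _](_ : _ = \sum_(j in t @: P) F j).
  by rewrite lerDl sumr_ge0.
apply: eq_bigl => j; apply: andb_idl => /imsetP[i Pi ->]; exact: PQ.
Qed.

(* Either t hits i0, or the smallest of the l (t k) is at most s / h.+1 <= c; in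
   both cases some factor is at most c and the others sum to at most s. *)
Lemma prod_le_isolated n h (l : 'I_n -> R) (c s : R) i0
    (t : {ffun 'I_h.+1 -> 'I_n}) :
  (forall i, 0 <= l i) -> l i0 = c -> \sum_(i | i != i0) l i <= s ->
  s <= h.+1%:R * c -> injective t ->
  \prod_k l (t k) <= c * (s / h%:R) ^+ h.
Proof.
move=> l_ge0 l_i0 sum_l le_sc t_inj.
have [k0 le_k0 le_s] : exists2 k0, l (t k0) <= c &
    \sum_(k | k != k0) l (t k) <= s.
  have [/existsP[k0 /eqP tk0]|/existsPn no_i0] := boolP [exists k, t k == i0].
    exists k0; first by rewrite tk0 l_i0.
    apply: le_trans sum_l; apply: ler_sum_inj => // k.
    by rewrite -tk0 (inj_eq t_inj).
  have sum_t : \sum_k l (t k) <= s.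
    by apply: le_trans sum_l; apply: ler_sum_inj.
  have [/existsP[k0 le_k0]|/existsPn gt_c] := boolP [exists k, l (t k) <= c].
    exists k0 => //; apply: le_trans sum_t.
    by rewrite [leRHS](bigD1 k0) //= lerDr.
  have : \sum_(k < h.+1) c < \sum_k l (t k).
    apply: ltr_sum; last by move=> k _; rewrite ltNge gt_c.
    by apply/hasP; exists ord0; rewrite ?mem_index_enum.
  rewrite sumr_const card_ord -mulr_natl => lt_c.
  by have := lt_le_trans lt_c (le_trans sum_t le_sc); rewrite ltxx.
rewrite (bigD1 k0) //=; apply: ler_pM => //; first exact: prodr_ge0.
(* AM-GM on the [h] factors other than [k0]. For [h = 0] the product is empty and the power is 1, so
   the division by zero is harmless. *)
have := @leif_AGM R 'I_h.+1 (predC1 k0) (fun k => l (t k)).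
rewrite /= cardC1 card_ord /= => AGM.
apply: le_trans (leif_le (AGM _)) _ => //.
have h_ge0 : 0 <= h%:R^-1 :> R by rewrite invr_ge0 ler0n.
by rewrite lerXn2r ?nnegrE ?mulr_ge0 ?sumr_ge0 ?ler_wpM2r //
  (le_trans _ le_s) ?sumr_ge0.
Qed.

End ProductBound.

(** * Norm bound for the compounds of a factored matrix *)

Section CompoundNorm.
Variable R : realType.
Local Notation C := R[i].
Local Notation rc := (real_complex R).

Lemma ext_tensor_map (K L : comNzRingType) (f : {rmorphism K -> L}) h m n
    (M : 'M[K]_(m, n)) (x : hsub n h -> K) t :
  f (ext_tensor M x t) = ext_tensor (map_mx f M) (fun S => f (x S)) t.
Proof.
rewrite /ext_tensor rmorph_sum; apply: eq_bigr => S _; rewrite rmorphM.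
rewrite -det_map_mx; congr (_ * \det _); apply/matrixP => i j.
by rewrite !mxE.
Qed.

(** Serves both the embedding of the reals into [C] and complex conjugation. *)
Lemma tensor_act_map (K L : comNzRingType) (f : {rmorphism K -> L}) h m n
    (M : 'M[K]_(m, n)) (X : {ffun 'I_h -> 'I_n} -> K) t :
  f (tensor_act M X t) = tensor_act (map_mx f M) (fun s => f (X s)) t.
Proof.
rewrite /tensor_act rmorph_sum; apply: eq_bigr => s _.
rewrite rmorphM rmorph_prod; congr (_ * _).
by apply: eq_bigr => i _; rewrite mxE.
Qed.

(** In the eigenbasis, the tensor power of [P] is diagonal with entries the products of the
    [l (t k)]. The rotated tensor [Z] is again antisymmetric, so only injective [t] contribute, and
    there the product is at most [b]. *)
Lemma tensor_quad_spectral_le h m n (P : 'M[R]_m) (Q : 'M[C]_m) (l : 'I_m -> R)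
    (b : R) (N : 'M[R]_(m, n)) (x : hsub n h -> R) :
  adjmx Q *m Q = 1%:M ->
  map_mx rc P = adjmx Q *m diag_mx (\row_i rc (l i)) *m Q ->
  (forall t : {ffun 'I_h -> 'I_m}, injective t -> \prod_k l (t k) <= b) ->
  tensor_dot (ext_tensor N x) (tensor_act P (ext_tensor N x)) <=
  b * tensor_dot (ext_tensor N x) (ext_tensor N x).
Proof.
move=> QQ PE l_le; set W := ext_tensor N x.
pose Wc t := rc (W t); pose Z := tensor_act Q Wc.
have WcE t : Wc t = ext_tensor (map_mx rc N) (fun S => rc (x S)) t.
  exact: ext_tensor_map.
have Z0 (t : {ffun 'I_h -> 'I_m}) : ~~ injectiveb t -> Z t = 0.
  move=> t_ninj; rewrite /Z (eq_tensor_act _ WcE) tensor_act_ext.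
  by rewrite ext_tensor_ninj.
have conjZ t : tensor_act (adjmx Q)^T Wc t = conjc (Z t).
  rewrite /Z (tensor_act_map (@conjc R)).
  transitivity (tensor_act (map_mx conjc Q) Wc t).
    by congr tensor_act; apply/matrixP => i j; rewrite !mxE.
  by apply: eq_tensor_act => s; apply/esym/conjc_real.
have rc_dot (M : 'M[R]_m) : rc (tensor_dot W (tensor_act M W)) =
    tensor_dot Wc (tensor_act (map_mx rc M) Wc).
  rewrite /tensor_dot rmorph_sum; apply: eq_bigr => t _; rewrite rmorphM.
  by rewrite tensor_act_map.
have dotW : rc (tensor_dot W W) = \sum_t conjc (Z t) * Z t.
  rewrite -(eq_tensor_dot (frefl W) (tensor_act1 W)) rc_dot map_mx1 -QQ.
  rewrite -(eq_tensor_dot (frefl Wc) (tensor_act_mul _ _ _)).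
  rewrite -[adjmx Q in LHS]trmxK -tensor_act_tr.
  by apply: eq_bigr => t _; rewrite conjZ.
have dotPW : rc (tensor_dot W (tensor_act P W)) =
    \sum_(t : {ffun 'I_h -> 'I_m}) rc (\prod_k l (t k)) * (conjc (Z t) * Z t).
  rewrite rc_dot PE -mulmxA.
  rewrite -(eq_tensor_dot (frefl Wc) (tensor_act_mul _ _ _)).
  rewrite -[adjmx Q in LHS]trmxK -tensor_act_tr.
  rewrite -(eq_tensor_dot (frefl _) (tensor_act_mul _ _ _)).
  apply: eq_bigr => t _; rewrite conjZ tensor_act_diag mulrCA; congr (_ * _).
  by rewrite rmorph_prod; apply: eq_bigr => k _; rewrite mxE.
rewrite -lecR rmorphM /= dotW dotPW mulr_sumr; apply: ler_sum => t _.
have [/injectiveP t_inj|t_ninj] := boolP (injectiveb t); last first.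
  by rewrite Z0 // !mulr0.
by rewrite ler_wpM2r ?lecR ?l_le // mulrC mulcJ_ge0.
Qed.

Lemma psd_mul_adj m n (M : 'M[C]_(m, n)) : psd (M *m adjmx M).
Proof.
move=> v; rewrite mulmxA -mulmxA.
have -> : adjmx v *m M = adjmx (adjmx M *m v).
  apply/matrixP => i j; rewrite !mxE rmorph_sum; apply: eq_bigr => k _.
  by rewrite !mxE rmorphM /= conjcK mulrC.
by rewrite mxE sumr_ge0 // => k _; rewrite mxE mulrC mulcJ_ge0.
Qed.

(** The factorisation of the correlation matrix; the case [f = e], [V = U] gives the Gram matrix of
    one factor. *)
Lemma mul_row_sqrt_scale m n k (e : 'cV[R]_m) (f : 'cV[R]_n)
    (U : 'M[R]_(m, k)) (V : 'M[R]_(n, k)) (c : R) : 0 <= c ->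
  row_mx (Num.sqrt c *: e) U *m (row_mx (Num.sqrt c *: f) V)^T =
  c *: (e *m f^T) + U *m V^T.
Proof.
move=> c_ge0; rewrite tr_row_mx mul_row_col linearZ /= -scalemxAl -scalemxAr.
by rewrite scalerA -expr2 sqr_sqrtr.
Qed.

(** Since [U] is orthogonal to [e], the vector [e] is an eigenvector for [c]. Any index [i0] at
    which [e] has a nonzero coordinate in the eigenbasis carries the eigenvalue [c], and the trace
    bounds the sum of the others. *)
Lemma gram_spectrum m k (e : 'cV[R]_m) (U : 'M[R]_(m, k)) (c s : R) :
  0 <= c -> e^T *m e = 1%:M -> e^T *m U = 0 -> \tr (U *m U^T) <= s ->
  exists (Q : 'M[C]_m) (l : 'I_m -> R) (i0 : 'I_m),
    [/\ adjmx Q *m Q = 1%:M,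
        map_mx rc (c *: (e *m e^T) + U *m U^T) =
          adjmx Q *m diag_mx (\row_i rc (l i)) *m Q,
        forall i, 0 <= l i, l i0 = c & \sum_(i | i != i0) l i <= s].
Proof.
move=> c_ge0 ee eU trU; set P := _ + _.
pose F := row_mx (Num.sqrt c *: e) U.
have PE : P = F *m F^T by rewrite mul_row_sqrt_scale.
have PcE : map_mx rc P = map_mx rc F *m adjmx (map_mx rc F).
  rewrite PE map_mxM; congr (_ *m _); apply/matrixP => i j.
  by rewrite !mxE; case: split => ?; rewrite ?mxE conjc_real.
have Pherm : Defs.hermitian (map_mx rc P).
  rewrite /Defs.hermitian; apply/matrixP => i j; rewrite mxE [in LHS]mxE conjc_real.
  have /matrixP/(_ j i) : P^T = P by rewrite PE trmx_mul trmxK.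
  by rewrite mxE => <-; rewrite [RHS]mxE.
have Ppsd : psd (map_mx rc P) by rewrite PcE; apply: psd_mul_adj.
have [Q [l [QQ l_ge0 PQ]]] := psd_spectral Pherm Ppsd.
have QQ' := mulmx1C QQ.
have Pe : P *m e = c *: e.
  rewrite mulmxDl -scalemxAl -!mulmxA ee mulmx1.
  have -> : U^T *m e = 0 by rewrite -[e]trmxK -trmx_mul eU trmx0.
  by rewrite mulmx0 addr0.
pose g := Q *m map_mx rc e.
have [i0 gi0] : exists i0, g i0 0 != 0.
  apply/existsP; apply: contraT => /existsPn g0.
  have g_eq0 : g = 0.
    by apply/colP => i; rewrite [RHS]mxE; apply/eqP; have := g0 i; rewrite negbK.
  have : map_mx rc (e^T *m e) = 0.
    by rewrite map_mxM -[map_mx rc e]mul1mx -QQ -mulmxA -/g g_eq0 !mulmx0.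
  rewrite ee map_mx1 => /matrixP/(_ 0 0)/eqP.
  by rewrite !mxE oner_eq0.
have l_i0 : l i0 = c.
  have : diag_mx (\row_i rc (l i)) *m g = rc c *: g.
    have := congr1 (mulmx Q) (congr1 (map_mx rc) Pe).
    by rewrite map_mxM PQ -!mulmxA (mulmxA Q) QQ' mul1mx -/g map_mxZ -scalemxAr.
  clearbody g; move=> /colP/(_ i0); rewrite mul_diag_mx !mxE => /(mulIf gi0).
  exact: complexI.
exists Q, l, i0; split=> //.
have : \sum_i l i = c + \tr (U *m U^T).
  apply: (@complexI R); rewrite rmorph_sum.
  transitivity (\tr (map_mx rc P)).
    rewrite PQ mxtrace_mulC mulmxA QQ' mul1mx mxtrace_diag.
    by apply: eq_bigr => i _; rewrite mxE.
  rewrite trace_map_mx /P mxtraceD mxtraceZ mxtrace_mulC ee mxtrace1.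
  by rewrite mulr1.
by rewrite (bigD1 i0) //= l_i0 => /addrI ->.
Qed.

Lemma schatten_inf_le (I J : finType) (K : I -> J -> R) (b : R) : 0 <= b ->
  (forall x : J -> R, \sum_i (\sum_j K i j * x j) ^+ 2 <= b ^+ 2 * \sum_j x j ^+ 2) ->
  schatten_inf K <= b.
Proof.
move=> b_ge0 K_le; apply: ge_sup.
  (* The zero vector shows that the set under the [sup] is nonempty. *)
  exists (vnorm (fun i => \sum_j K i j * 0)), (fun=> 0) => //=.
  by rewrite /vnorm big1 ?sqrtr0 // => j _; rewrite expr0n.
move=> _ [x /= x_le <-]; rewrite /vnorm -(ger0_norm b_ge0) -sqrtr_sqr.
have x_le1 : \sum_j x j ^+ 2 <= 1.
  rewrite -sqrtr1 in x_le; move: x_le; rewrite /vnorm ler_sqrt ?ltr01 //.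
apply: ler_wsqrtr; apply: le_trans (K_le x) _.
by rewrite ler_piMr // sqr_ge0.
Qed.

(** Let [X] be the tensor of [x] and [W] its image under [M]. Moving [FU] across the inner product
    writes the squared norm of [W] as a product of [FU^T W] with [FV^T X]. Cauchy-Schwarz and the
    spectral bound on each factor then give the bound [b]. *)
Lemma schatten_compound_le h m n k (e : 'cV[R]_m) (f : 'cV[R]_n)
    (U : 'M[R]_(m, k)) (V : 'M[R]_(n, k)) (c s : R) :
  0 <= c -> 0 <= s -> s <= h.+1%:R * c ->
  e^T *m e = 1%:M -> e^T *m U = 0 -> \tr (U *m U^T) <= s ->
  f^T *m f = 1%:M -> f^T *m V = 0 -> \tr (V *m V^T) <= s ->
  schatten_inf (@compound _ _ _ (c *: (e *m f^T) + U *m V^T) h.+1) <=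
  c * (s / h%:R) ^+ h.
Proof.
move=> c_ge0 s_ge0 le_sc ee eU trU ff fV trV.
set M := _ + _; set b := c * _.
have b_ge0 : 0 <= b by rewrite mulr_ge0 // exprn_ge0 // divr_ge0.
(* One bound for both factors: it is used with [N = M] on the side of [U] and with [N = 1] on the
   side of [V]. *)
have quad_le p q (e1 : 'cV[R]_p) (U1 : 'M[R]_(p, k)) (N : 'M[R]_(p, q))
    (x : hsub q h.+1 -> R) :
    e1^T *m e1 = 1%:M -> e1^T *m U1 = 0 -> \tr (U1 *m U1^T) <= s ->
    forall W F, W = ext_tensor N x -> F = (row_mx (Num.sqrt c *: e1) U1)^T ->
    tensor_dot (tensor_act F W) (tensor_act F W) <= b * tensor_dot W W.
  move=> e1e1 e1U1 trU1 W F WE FE.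
  have [Q [l [i0 [QQ PQ l_ge0 l_i0 sum_l]]]] := gram_spectrum c_ge0 e1e1 e1U1 trU1.
  rewrite tensor_act_tr (eq_tensor_dot (frefl _) (tensor_act_mul _ _ _)).
  rewrite {1}FE trmxK.
  have <- : c *: (e1 *m e1^T) + U1 *m U1^T = row_mx (Num.sqrt c *: e1) U1 *m F.
    by rewrite FE mul_row_sqrt_scale.
  rewrite WE; apply: tensor_quad_spectral_le QQ PQ _ => t t_inj.
  exact: prod_le_isolated l_ge0 l_i0 sum_l le_sc t_inj.
apply: schatten_inf_le => // x.
pose X := ext_tensor (1%:M : 'M[R]_n) x; pose W := ext_tensor M x.
pose FU := row_mx (Num.sqrt c *: e) U; pose FV := row_mx (Num.sqrt c *: f) V.
have ME : M = FU *m FV^T by rewrite mul_row_sqrt_scale.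
have WE : W =1 tensor_act FU (tensor_act FV^T X).
  by move=> t; rewrite tensor_act_mul tensor_act_ext mulmx1 -ME.
have dotW : tensor_dot W W = tensor_dot (tensor_act FU^T W) (tensor_act FV^T X).
  rewrite (eq_tensor_dot WE (frefl _)) [RHS]tensor_act_tr trmxK.
  by apply: eq_bigr => t _; rewrite mulrC.
have leU := quad_le _ _ e U M x ee eU trU _ _ erefl erefl.
have leV := quad_le _ _ f V 1%:M x ff fV trV _ _ erefl erefl.
have W_ge0 : 0 <= tensor_dot W W by apply: sumr_ge0 => t _; rewrite -expr2 sqr_ge0.
have X_ge0 : 0 <= tensor_dot X X by apply: sumr_ge0 => t _; rewrite -expr2 sqr_ge0.
have : tensor_dot W W <= b ^+ 2 * tensor_dot X X.
  (* Cauchy-Schwarz bounds the square of [tensor_dot W W], so one factor has to be cancelled. *)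
  have [->|W_neq0] := eqVneq (tensor_dot W W) 0.
    by rewrite mulr_ge0 // sqr_ge0.
  have W_gt0 : 0 < tensor_dot W W by rewrite lt_def W_neq0.
  rewrite -(ler_pM2l W_gt0) -expr2 {1}dotW.
  apply: le_trans (cauchy_schwarz_sum _ _) _.
  apply: le_trans (ler_pM _ _ leU leV) _;
    try by apply: sumr_ge0 => t _; rewrite -expr2 sqr_ge0.
  by rewrite -/W -/X mulrACA -expr2 mulrCA.
rewrite tensor_dot_ext tensor_dot_ext1 mulrCA ler_pM2l //.
by rewrite ltr0n fact_gt0.
Qed.

End CompoundNorm.

(** * Bloch vectors and the rescaling of the two sides *)

Section Bloch.
Variable R : realType.
Local Notation C := R[i].
Local Notation rc := (real_complex R).

Lemma mxtrace_tens m n (X : 'M[C]_m) (Y : 'M[C]_n) :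
  \tr (X *t Y) = \tr X * \tr Y.
Proof. by rewrite /mxtrace mulr_sum; apply: eq_bigr => i _; rewrite mxE. Qed.

Lemma mxtrace_mulE n (X Y : 'M[C]_n) :
  \tr (X *m Y) = \sum_k mxvec X 0 k * mxvec Y^T 0 k.
Proof.
rewrite (reindex _ (curry_mxvec_bij _ _)) /=.
rewrite /mxtrace; under [LHS]eq_bigr do rewrite mxE.
by rewrite pair_bigA; apply: eq_bigr => -[i j] _; rewrite !mxvecE mxE.
Qed.

(** Orthonormality says [K *m L = 1]. Both matrices are square, as [n ^ 2] is convertible to
    [n * n], so [L *m K = 1] too, which is completeness of the basis. *)
Lemma orthonormal_herm_parseval n (A : 'I_(n ^ 2) -> 'M[C]_n) (X Y : 'M[C]_n) :
  orthonormal_herm_basis A ->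
  \tr (X *m Y) = \sum_i \tr (X *m A i) * \tr (Y *m A i).
Proof.
move=> [_ Aon].
pose K : 'M[C]_(n * n) := \matrix_(i, k) mxvec (A i) 0 k.
pose L : 'M[C]_(n * n) := \matrix_(k, i) mxvec (A i)^T 0 k.
have KL : K *m L = 1%:M.
  apply/matrixP => i j; rewrite !mxE -Aon mxtrace_mulE.
  by apply: eq_bigr => k _; rewrite !mxE.
have -> : \tr (X *m Y) = ((mxvec X *m L) *m (K *m (mxvec Y^T)^T)) 0 0.
  rewrite !mulmxA -[_ *m L *m K]mulmxA (mulmx1C KL) mulmx1 mxtrace_mulE mxE.
  by apply: eq_bigr => k _; rewrite [in RHS]mxE.
rewrite mxE; apply: eq_bigr => i _; congr (_ * _).
  by rewrite mxtrace_mulE mxE; apply: eq_bigr => k _; rewrite [L _ _]mxE.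
rewrite mxtrace_mulC mxtrace_mulE mxE; apply: eq_bigr => k _.
by rewrite [K _ _]mxE; congr (_ * _); rewrite [LHS]mxE.
Qed.

Lemma herm_trace_real n (X Y : 'M[C]_n) :
  Defs.hermitian X -> Defs.hermitian Y ->
  rc (complex.Re (\tr (X *m Y))) = \tr (X *m Y).
Proof.
move=> Xh Yh; apply: RRe_real; apply/CrealP.
change (conjc (\tr (X *m Y)) = \tr (X *m Y)).
rewrite [in RHS]mxtrace_mulC /mxtrace rmorph_sum; apply: eq_bigr => i _.
rewrite !mxE rmorph_sum; apply: eq_bigr => j _; rewrite rmorphM mulrC.
by rewrite -[in RHS]Xh -[in RHS]Yh !mxE.
Qed.

Definition bloch n (A : 'I_(n ^ 2) -> 'M[C]_n) (X : 'M[C]_n) : 'cV[R]_(n ^ 2) :=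
  \col_i complex.Re (\tr (X *m A i)).

Lemma bloch_dot n (A : 'I_(n ^ 2) -> 'M[C]_n) (X Y : 'M[C]_n) :
  orthonormal_herm_basis A -> Defs.hermitian X -> Defs.hermitian Y ->
  rc (((bloch A X)^T *m bloch A Y) 0 0) = \tr (X *m Y).
Proof.
move=> Aon Xh Yh; rewrite (orthonormal_herm_parseval X Y Aon) mxE rmorph_sum.
apply: eq_bigr => i _; rewrite !mxE rmorphM /= !herm_trace_real //; exact: Aon.1.
Qed.

Lemma hermitian_sub_scale n (X Y : 'M[C]_n) (a : R) :
  Defs.hermitian X -> Defs.hermitian Y -> Defs.hermitian (X - rc a *: Y).
Proof.
move=> Xh Yh; apply/matrixP => i j.
rewrite !mxE -[in RHS]Xh -[in RHS]Yh !mxE rmorphB rmorphM.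
by congr (_ - _ * _); apply: conjc_real.
Qed.

Lemma hermitian1 n : Defs.hermitian (1%:M : 'M[C]_n).
Proof. by apply/matrixP => i j; rewrite !mxE conjc_nat eq_sym. Qed.

(** One party's half of the decomposition: [e] is the normalised Bloch vector of the identity and
    [a l] that of the traceless part [r' l]. Orthogonality is tracelessness, and the norm bound is
    purity minus [1/n]. *)
Lemma separable_side n k (A : 'I_(n ^ 2) -> 'M[C]_n) (p : 'I_k -> R)
    (r : 'I_k -> 'M[C]_n) :
  (0 < n)%N -> orthonormal_herm_basis A -> \sum_l p l = 1 ->
  (forall l, density (r l)) ->
  (forall X, Defs.hermitian X -> \tr X = 0 ->
    \sum_l rc (p l) * \tr (r l *m X) = 0) ->
  exists (e : 'cV[R]_(n ^ 2)) (a : 'I_k -> 'cV[R]_(n ^ 2)),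
    [/\ e^T *m e = 1%:M, forall l, e^T *m a l = 0,
        forall l, \tr (a l *m (a l)^T) <= 1 - n%:R^-1,
        \sum_l p l *: a l = 0 &
        forall l i, \tr (r l *m A i) =
                    rc ((Num.sqrt n%:R)^-1 * e i 0 + a l i 0)].
Proof.
move=> n_gt0 Aon sump rd marg.
have n_neq0 : n%:R != 0 :> R by rewrite pnatr_eq0 -lt0n.
pose q : R := Num.sqrt n%:R.
have q2 : q * q = n%:R by rewrite -expr2 sqr_sqrtr // ler0n.
have q_neq0 : q != 0 by apply: contraNneq n_neq0 => q0; rewrite -q2 q0 mul0r.
have mx1P (M N : 'M[R]_1) : rc (M 0 0) = rc (N 0 0) -> M = N.
  by move=> /complexI MN; rewrite [M]mx11_scalar [N]mx11_scalar MN.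
pose r' l := r l - rc n%:R^-1 *: 1%:M.
have r'h l : Defs.hermitian (r' l).
  by apply: hermitian_sub_scale; [case: (rd l)|apply: hermitian1].
have rcn : rc n%:R^-1 * n%:R = 1.
  by rewrite -(rmorph_nat rc n) -rmorphM mulVf // rmorph1.
have tr_r' l : \tr (r' l) = 0.
  have [_ _ trr] := rd l.
  by rewrite /r' raddfB /= mxtraceZ mxtrace1 trr rcn subrr.
exists (q^-1 *: bloch A 1%:M), (fun l => bloch A (r' l)); split.
- apply: mx1P; rewrite [(_ *: _)^T]linearZ /= -scalemxAl -scalemxAr scalerA.
  rewrite mxE rmorphM /= bloch_dot //; try exact: hermitian1.
  rewrite mulmx1 mxtrace1 -(rmorph_nat rc n) -rmorphM -q2 [in RHS]mxE rmorph1.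
  by rewrite mulrA mulfVK // mulVf // rmorph1.
- move=> l; apply: mx1P; rewrite [(_ *: _)^T]linearZ /= -scalemxAl mxE rmorphM /=.
  rewrite bloch_dot //; last exact: hermitian1.
  by rewrite mul1mx tr_r' mulr0 mxE rmorph0.
- move=> l; rewrite mxtrace_mulC trace_mx11 -lecR bloch_dot //.
  have -> : \tr (r' l *m r' l) = \tr (r l *m r l) - rc n%:R^-1.
    have [_ _ trr] := rd l.
    rewrite {2}/r' mulmxBr -scalemxAr mulmx1 raddfB /= mxtraceZ tr_r' mulr0 subr0.
    by rewrite /r' mulmxBl -scalemxAl mul1mx raddfB /= mxtraceZ trr mulr1.
  by rewrite rmorphB rmorph1 lerB // density_purity.
- apply/colP => i; rewrite summxE [RHS]mxE.
  (* The traceless part of [A i]: pairing it with [r l] equals pairing [A i] with [r' l], so [marg]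
     applies. *)
  pose X := A i - rc (complex.Re (\tr (1%:M *m A i)) / n%:R) *: 1%:M.
  have Xh : Defs.hermitian X by apply: hermitian_sub_scale; [exact: Aon.1|apply: hermitian1].
  have trE : \tr (A i) = rc (complex.Re (\tr (1%:M *m A i))).
    by rewrite herm_trace_real ?mul1mx //; [apply: hermitian1|apply: Aon.1].
  have trX : \tr X = 0.
    rewrite /X raddfB /= mxtraceZ mxtrace1 rmorphM -mulrA /= rcn mulr1 trE.
    by rewrite subrr.
  apply: (@complexI R); rewrite rmorph0 -(marg X Xh trX) rmorph_sum.
  apply: eq_bigr => l _; rewrite !mxE rmorphM /= herm_trace_real //; last exact: Aon.1.
  congr (_ * _); have [_ _ trr] := rd l.
  rewrite /r' /X mulmxBl mulmxBr !raddfB /= -scalemxAl -scalemxAr !mxtraceZ.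
  by rewrite mul1mx mulmx1 trr trE rmorphM /= mulr1 mulrC.
- move=> l i; rewrite mxE mulrA -/q -invfM q2 rmorphD rmorphM /= !mxE.
  rewrite !herm_trace_real //; try exact: Aon.1; try exact: hermitian1.
  by rewrite /r' mulmxBl -scalemxAl raddfB /= mxtraceZ mul1mx addrC subrK.
Qed.

(** For positive [u] and [v], taking [la ^+ 2 = sqrt (u * v) / u] makes both scaled quantities equal
    to the geometric mean. *)
Lemma balance_scaling (u v : R) : 0 <= u -> 0 <= v -> (u == 0) = (v == 0) ->
  exists2 la : R, la != 0 &
    la ^+ 2 * u <= Num.sqrt (u * v) /\ la^-1 ^+ 2 * v <= Num.sqrt (u * v).
Proof.
move=> u_ge0 v_ge0 uv0.
have [u0|u_neq0] := eqVneq u 0.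
  have v0 : v = 0 by apply/eqP; rewrite -uv0 u0.
  by exists 1; rewrite ?oner_eq0 // u0 v0 !mulr0 sqrtr0.
have u_gt0 : 0 < u by rewrite lt_def u_neq0.
have v_gt0 : 0 < v by rewrite lt_def -uv0 u_neq0.
have s_gt0 : 0 < Num.sqrt (u * v) by rewrite sqrtr_gt0 mulr_gt0.
have ss : Num.sqrt (u * v) * Num.sqrt (u * v) = u * v.
  by rewrite -expr2 sqr_sqrtr // mulr_ge0.
have su_gt0 : 0 < Num.sqrt (u * v) / u by rewrite divr_gt0.
exists (Num.sqrt (Num.sqrt (u * v) / u)); first by rewrite gt_eqF // sqrtr_gt0.
rewrite exprVn (sqr_sqrtr (ltW su_gt0)) invfM invrK; split; first by rewrite divfK.
by rewrite -mulrA -[X in _ * X <= _]ss mulKf // gt_eqF.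
Qed.

End Bloch.

(** * Correlation matrices of separable states in normal form *)

Section Separable.
Variable R : realType.
Local Notation C := R[i].
Local Notation rc := (real_complex R).

Lemma density_dim_gt0 n (X : 'M[C]_n) : density X -> (0 < n)%N.
Proof.
by case: n X => [|//] X [_ _ /eqP]; rewrite /mxtrace big_ord0 eq_sym oner_eq0.
Qed.

Lemma trace_scaled_cols m k (w : 'I_k -> R) (a : 'I_k -> 'cV[R]_m) :
  let U := \matrix_(i, l) (w l * a l i 0) in
  \tr (U *m U^T) = \sum_l w l ^+ 2 * \tr (a l *m (a l)^T).
Proof.
move=> U; rewrite mxtrace_mulC; apply: eq_bigr => l _.
rewrite mxE mxtrace_mulC trace_mx11 mxE mulr_sumr.
by apply: eq_bigr => i _; rewrite !mxE; ring.
Qed.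

Lemma mul_scaled_cols m k (e : 'cV[R]_m) (w : 'I_k -> R) (a : 'I_k -> 'cV[R]_m) :
  (forall l, e^T *m a l = 0) -> e^T *m \matrix_(i, l) (w l * a l i 0) = 0.
Proof.
move=> ea0; apply/matrixP => o l; rewrite ord1 {o}.
have /matrixP/(_ 0 0) := ea0 l; rewrite mxE [RHS]mxE => ea.
rewrite mxE [RHS]mxE -[RHS](mulr0 (w l)) -[in RHS]ea mulr_sumr.
by apply: eq_bigr => i _; rewrite !mxE; ring.
Qed.

Lemma trace_sep_tens k dA dB (p : 'I_k -> R) (rA : 'I_k -> 'M[C]_dA)
    (rB : 'I_k -> 'M[C]_dB) (X : 'M[C]_dA) (Y : 'M[C]_dB) :
  \tr ((\sum_l rc (p l) *: (rA l *t rB l)) *m (X *t Y)) =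
  \sum_l rc (p l) * (\tr (rA l *m X) * \tr (rB l *m Y)).
Proof.
rewrite mulmx_suml raddf_sum; apply: eq_bigr => l _ /=.
by rewrite -scalemxAl mxtraceZ tensmx_mul mxtrace_tens.
Qed.

Lemma M_h_inf_le dA dB (A : 'I_(dA ^ 2) -> 'M[C]_dA) (B : 'I_(dB ^ 2) -> 'M[C]_dB)
    (rho : 'M[C]_(dA * dB)) (h : nat) :
  orthonormal_herm_basis A -> orthonormal_herm_basis B ->
  separable rho -> filter_normal_form rho ->
  (dA == 1%N) = (dB == 1%N) -> Num.sqrt ((dA * dB)%:R : R) <= h.+1%:R ->
  M_h_inf rho A B h.+1 <=
    (Num.sqrt (dA * dB)%:R)^-1 *
    (Num.sqrt ((1 - dA%:R^-1) * (1 - dB%:R^-1)) / h%:R) ^+ h.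
Proof.
move=> Aon Bon [k [p [rA [rB [p_ge0 sump dAd dBd ->]]]]] [fA fB] dAB1 h_ge.
have [l0 _] : exists l0 : 'I_k, true.
  case: k p {rA rB p_ge0 dAd dBd fA fB} sump => [|k] p; last by exists ord0.
  by rewrite big_ord0 => /eqP; rewrite eq_sym oner_eq0.
have dA_gt0 := density_dim_gt0 (dAd l0); have dB_gt0 := density_dim_gt0 (dBd l0).
have [X Xh X0|e [a [ee ea na suma trA]]] := separable_side dA_gt0 Aon sump dAd.
  rewrite -[RHS](fA X Xh X0) trace_sep_tens; apply: eq_bigr => l _.
  by case: (dBd l) => _ _; rewrite mulmx1 => ->; rewrite mulr1.
have [Y Yh Y0|f [b [ff fb nb sumb trB]]] := separable_side dB_gt0 Bon sump dBd.
  rewrite -[RHS](fB Y Yh Y0) trace_sep_tens; apply: eq_bigr => l _.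
  by case: (dAd l) => _ _; rewrite mulmx1 => ->; rewrite mul1r.
set c := _^-1; set s := Num.sqrt _.
have u01 n : (0 < n)%N -> 0 <= (1 - n%:R^-1 : R) <= 1.
  move=> n_gt0; rewrite subr_ge0 invf_le1 ?ltr0n // ler1n n_gt0 /=.
  by rewrite gerBl invr_ge0 ler0n.
have u_eq0 n : (0 < n)%N -> (1 - n%:R^-1 == 0 :> R) = (n == 1%N).
  by move=> n_gt0; rewrite subr_eq0 eq_sym invr_eq1 pnatr_eq1.
have /andP[uA0 uA1] := u01 _ dA_gt0; have /andP[uB0 uB1] := u01 _ dB_gt0.
have [|la la0 [laA laB]] := balance_scaling uA0 uB0; first by rewrite !u_eq0.
have c_ge0 : 0 <= c by rewrite invr_ge0 sqrtr_ge0.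
have q_gt0 : 0 < Num.sqrt ((dA * dB)%:R : R).
  by rewrite sqrtr_gt0 ltr0n muln_gt0 dA_gt0.
(* The two numbers are separated by 1. *)
have le_sc : s <= h.+1%:R * c.
  apply: (@le_trans _ _ 1); last by rewrite ler_pdivlMr // mul1r.
  by rewrite -sqrtr1 ler_wsqrtr // mulr_ile1.
(* Each weight [p l] is shared equally between the two sides. The factor [la] cancels in [U *m V^T]
   and brings both traces below [s]. *)
pose U := \matrix_(i, l) (la * Num.sqrt (p l) * a l i 0).
pose V := \matrix_(i, l) (la^-1 * Num.sqrt (p l) * b l i 0).
have tr_le n (w x : R) (g : 'I_k -> 'cV[R]_n) :
    (forall l, \tr (g l *m (g l)^T) <= x) -> w ^+ 2 * x <= s ->
    \sum_l (w * Num.sqrt (p l)) ^+ 2 * \tr (g l *m (g l)^T) <= s.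
  move=> g_le; apply: le_trans; rewrite -[leRHS]mul1r -sump mulr_suml.
  apply: ler_sum => l _; rewrite exprMn sqr_sqrtr //.
  by rewrite mulrAC mulrC ler_wpM2l // ler_wpM2l // sqr_ge0.
have -> : M_h_inf (\sum_l rc (p l) *: (rA l *t rB l)) A B h.+1 =
    schatten_inf (@compound _ _ _ (c *: (e *m f^T) + U *m V^T) h.+1).
  rewrite /M_h_inf; congr (schatten_inf (@compound _ _ _ _ _)).
  apply/matrixP => i j; rewrite mxE trace_sep_tens.
  pose al : R := (Num.sqrt dA%:R)^-1; pose be : R := (Num.sqrt dB%:R)^-1.
  rewrite (eq_bigr (fun l => rc (p l * ((al * e i 0 + a l i 0) *
    (be * f j 0 + b l j 0))))) => [|l _]; last by rewrite trA trB !rmorphM.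
  rewrite -rmorph_sum /=.
  have cE : c = al * be by rewrite /c natrM sqrtrM ?ler0n // invfM.
  have sa0 : \sum_l p l * a l i 0 = 0.
    have /colP/(_ i) := suma; rewrite summxE [RHS]mxE; apply: etrans.
    by apply: eq_bigr => l _; rewrite mxE.
  have sb0 : \sum_l p l * b l j 0 = 0.
    have /colP/(_ j) := sumb; rewrite summxE [RHS]mxE; apply: etrans.
    by apply: eq_bigr => l _; rewrite mxE.
  (* The two cross terms vanish because the weighted means of the [a l] and of the [b l] are
     zero. *)
  transitivity (\sum_l (p l * (al * be * e i 0 * f j 0) + p l * a l i 0 * (be * f j 0)
     + p l * b l j 0 * (al * e i 0) + p l * a l i 0 * b l j 0)).
    by apply: eq_bigr => l _; ring.
  rewrite !big_split /= -!mulr_suml sa0 sb0 sump mul1r !mul0r !addr0.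
  rewrite !mxE big_ord1 !mxE cE mulrA; congr (_ + _).
  apply: eq_bigr => l _; rewrite !mxE.
  transitivity ((la / la) * (Num.sqrt (p l) ^+ 2) * (a l i 0 * b l j 0)).
    by rewrite divff // mul1r sqr_sqrtr // mulrA.
  by ring.
apply: schatten_compound_le => //.
- exact: sqrtr_ge0.
- exact: mul_scaled_cols.
- by rewrite trace_scaled_cols; apply: tr_le laA.
- exact: mul_scaled_cols.
- by rewrite trace_scaled_cols; apply: tr_le laB.
Qed.

End Separable.

(** * Degenerate parameters and the final form of the bound *)

Theorem theorem3 (R : realType) (dA dB : nat)
  (A : 'I_(dA ^ 2) -> 'M[R[i]]_dA) (B : 'I_(dB ^ 2) -> 'M[R[i]]_dB)
  (rho : 'M[R[i]]_(dA * dB)) (h : nat) :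
  orthonormal_herm_basis (R := R) A -> orthonormal_herm_basis (R := R) B ->
  separable (R := R) rho -> filter_normal_form (R := R) rho ->
  let d := minn dA dB in
  let D := maxn dA dB in
  Num.sqrt ((D * d)%:R : R) <= h%:R -> (h <= d ^ 2)%N ->
  M_h_inf (R := R) rho A B h <=
    (Num.sqrt ((D * d)%:R))^-1 *
    Num.sqrt (((D%:R - 1) / (D%:R * (h%:R - 1))) *
              ((d%:R - 1) / (d%:R * (h%:R - 1)))) ^+ (h - 1).
Proof.
move=> Aon Bon sep fnf d D h_ge h_le.
have [dA_gt0 dB_gt0] : (0 < dA)%N /\ (0 < dB)%N.
  have [k [p [rA [rB [_ sump dAd dBd _]]]]] := sep.
  case: k p rA rB sump dAd dBd => [|k] p rA rB sump dAd dBd.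
    by move: sump; rewrite big_ord0 => /eqP; rewrite eq_sym oner_eq0.
  by split; [apply: density_dim_gt0 (dAd ord0)|apply: density_dim_gt0 (dBd ord0)].
have DdE : (D * d = dA * dB)%N by rewrite /d /D; case: leqP => _; rewrite // mulnC.
have Dd_le : (D * d <= h ^ 2)%N.
  rewrite -(ler_nat R) natrX -[leLHS]sqr_sqrtr ?ler0n //.
  by rewrite lerXn2r ?nnegrE ?sqrtr_ge0 ?ler0n.
case: h h_ge h_le Dd_le => [|h] h_ge h_le Dd_le.
  by move: Dd_le; rewrite DdE exp0n // leqNgt muln_gt0 dA_gt0 dB_gt0.
(* If [d = 1], then [h <= d ^ 2] forces the original [h] to be 1, and [D * d <= h ^ 2] gives
   [D = 1]. Hence the two Bloch radii vanish together, as the balancing requires. *)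
have dAB1 : (dA == 1%N) = (dB == 1%N).
  have d1 : d = 1%N -> D = 1%N.
    move=> d1; rewrite d1 exp1n in h_le; move: h_le Dd_le; rewrite ltnS leqn0 d1.
    move=> /eqP->; rewrite muln1 exp1n /D => D_le; apply/eqP.
    by rewrite eqn_leq D_le leq_max dA_gt0.
  rewrite /d /D in d1; apply/eqP/eqP => [dA1|dB1].
    have := d1; rewrite dA1 (minn_idPl dB_gt0) (maxn_idPr dB_gt0); exact.
  have := d1; rewrite dB1 (minn_idPr dA_gt0) (maxn_idPl dA_gt0); exact.
rewrite DdE in h_ge *; apply: le_trans (M_h_inf_le Aon Bon sep fnf dAB1 h_ge) _.
rewrite subn1 /= -[h.+1%:R]natr1 addrK.
suff -> : Num.sqrt ((1 - dA%:R^-1) * (1 - dB%:R^-1)) / h%:R =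
  Num.sqrt ((D%:R - 1) / (D%:R * h%:R) * ((d%:R - 1) / (d%:R * h%:R))) :> R by [].
(* Valid for [h = 0] as well, where both sides are 0 because the inverse of 0 is 0. *)
have uE n : (0 < n)%N -> (n%:R - 1) / (n%:R * h%:R) = (1 - n%:R^-1) / h%:R :> R.
  move=> n_gt0; rewrite invfM mulrA mulrBl mul1r divff //.
  by rewrite pnatr_eq0 -lt0n.
have D_gt0 : (0 < D)%N by rewrite leq_max dA_gt0.
have d_gt0 : (0 < d)%N by rewrite leq_min dA_gt0.
have h_ge0 : 0 <= h%:R^-1 :> R by rewrite invr_ge0 ler0n.
rewrite !uE // mulrACA -(expr2 h%:R^-1) [in RHS]mulrC [RHS]sqrtrM ?sqr_ge0 // sqrtr_sqr.
rewrite ger0_norm // [LHS]mulrC; congr (_ * Num.sqrt _).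
by rewrite /D /d; case: leqP => _; rewrite // mulrC.
Qed.
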